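(* For any partition $\lambda\vdash n$ and any positive integer $d$, $$\omega^{[d]}(p_\lambda)=\varepsilon_\lambda D^{[d]}_\lambda\,p_\lambda.$$ Namely, each power sum symmetric function $p_\lambda$ is an eigenvector of $\omega^{[d]}$ corresponding to the eigenvalue $\varepsilon_\lambda D^{[d]}_\lambda$.
   Context: $\Lambda$ is the ring of symmetric functions over $\mathbb{Q}$ in $x=(x_1,x_2,\ldots)$; $e_n$ and $p_\lambda$ are the elementary and power sum symmetric functions. For a positive integer $d$, $h_n^{[d]}$ is defined by $\sum_{n\ge 0}h_n^{[d]}(x)t^n=\prod_{k\ge 1}(1+x_kt+x_k^2t^2+\cdots+x_k^dt^d)$. $\omega^{[d]}:\Lambda\to\Lambda$ is the algebra homomorphism determined by $\omega^{[d]}(e_n)=h_n^{[d]}$ for all $n$. For $\lambda=(1^{n_1},2^{n_2},\ldots)$ ($n_i$ parts equal to $i$), $\varepsilon_\lambda=(-1)^{|\lambda|-\ell(\lambda)}$ with $\ell(\lambda)$ the number of nonzero parts, and $D^{[d]}_\lambda=(-d)^{\sum_{k\ge1}n_{k(d+1)}}$. *)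

(* Defs.v *)
From HB Require Import structures.
From mathcomp Require Import all_boot all_order all_fingroup all_algebra.
From mathcomp Require Import mpoly boolp.

Set Implicit Arguments.
Unset Strict Implicit.
Unset Printing Implicit Defensive.

Import GRing.Theory.
Local Open Scope ring_scope.

Definition polyfam : Type := forall m : nat, {mpoly rat[m]}.

HB.instance Definition _ := Choice.on polyfam.

Section PolyFam.
Implicit Types f g h : polyfam.

Definition pf_zero : polyfam := fun=> 0.
Definition pf_one : polyfam := fun=> 1.
Definition pf_add f g : polyfam := fun m => f m + g m.
Definition pf_opp f : polyfam := fun m => - f m.
Definition pf_mul f g : polyfam := fun m => f m * g m.
Definition pf_scale (c : rat) f : polyfam := fun m => c *: f m.

Fact pf_addA : associative pf_add.
Proof. by move=> f g h; apply: functional_extensionality_dep => m; exact: addrA. Qed.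
Fact pf_addC : commutative pf_add.
Proof. by move=> f g; apply: functional_extensionality_dep => m; exact: addrC. Qed.
Fact pf_add0 : left_id pf_zero pf_add.
Proof. by move=> f; apply: functional_extensionality_dep => m; exact: add0r. Qed.
Fact pf_addN : left_inverse pf_zero pf_opp pf_add.
Proof. by move=> f; apply: functional_extensionality_dep => m; exact: addNr. Qed.
HB.instance Definition _ :=
  GRing.isZmodule.Build polyfam pf_addA pf_addC pf_add0 pf_addN.

Fact pf_mulA : associative pf_mul.
Proof. by move=> f g h; apply: functional_extensionality_dep => m; exact: mulrA. Qed.
Fact pf_mulC : commutative pf_mul.
Proof. by move=> f g; apply: functional_extensionality_dep => m; exact: mulrC. Qed.
Fact pf_mul1 : left_id pf_one pf_mul.
Proof. by move=> f; apply: functional_extensionality_dep => m; exact: mul1r. Qed.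
Fact pf_mulD : left_distributive pf_mul pf_add.
Proof. by move=> f g h; apply: functional_extensionality_dep => m; exact: mulrDl. Qed.
Fact pf_one_neq0 : pf_one != pf_zero.
Proof.
by apply/eqP => /(congr1 (fun f : polyfam => f 0%N))/eqP; rewrite oner_eq0.
Qed.
HB.instance Definition _ := GRing.Zmodule_isComNzRing.Build polyfam
  pf_mulA pf_mulC pf_mul1 pf_mulD pf_one_neq0.

Fact pf_scaleA a b f : pf_scale a (pf_scale b f) = pf_scale (a * b) f.
Proof. by apply: functional_extensionality_dep => m; exact: scalerA. Qed.
Fact pf_scale1 : left_id 1 pf_scale.
Proof. by move=> f; apply: functional_extensionality_dep => m; exact: scale1r. Qed.
Fact pf_scaleDr : right_distributive pf_scale +%R.
Proof. by move=> c f g; apply: functional_extensionality_dep => m; exact: scalerDr. Qed.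
Fact pf_scaleDl f : {morph pf_scale^~ f : a b / a + b}.
Proof. by move=> a b; apply: functional_extensionality_dep => m; exact: scalerDl. Qed.
HB.instance Definition _ := GRing.Zmodule_isLmodule.Build rat polyfam
  pf_scaleA pf_scale1 pf_scaleDr pf_scaleDl.

Fact pf_scaleAl (c : rat) (f g : polyfam) : c *: (f * g) = (c *: f) * g.
Proof. by apply: functional_extensionality_dep => m; exact: scalerAl. Qed.
HB.instance Definition _ := GRing.Lmodule_isLalgebra.Build rat polyfam pf_scaleAl.
HB.instance Definition _ := GRing.Lalgebra_isComAlgebra.Build rat polyfam.

End PolyFam.

(* [mtrunc p] is p(x_0, ..., x_(m-1), 0). *)
Definition mtrunc_vars (m : nat) : m.+1.-tuple {mpoly rat[m]} :=
  [tuple oapp (fun j : 'I_m => 'X_j) 0 (unlift ord_max i) | i < m.+1].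

Definition mtrunc (m : nat) (p : {mpoly rat[m.+1]}) : {mpoly rat[m]} :=
  p \mPo mtrunc_vars m.

HB.instance Definition _ m :=
  GRing.LRMorphism.copy (@mtrunc m) (comp_mpoly (mtrunc_vars m)).

(* A symmetric function f in x_0, x_1, ... over Q (a symmetric power series of
   bounded degree) is encoded by its truncations f_m = f(x_0, ..., x_(m-1), 0, ...),
   i.e. the ring of symmetric functions is the limit, in the category of graded
   rings, of the rings of symmetric polynomials in m variables. *)
Definition symfun_family (f : polyfam) : Prop :=
  [/\ forall m, f m \is symmetric,
      forall m, mtrunc (f m.+1) = f m
    & exists D : nat, forall m, (msize (f m) <= D)%N].

Definition symfun_pred : {pred polyfam} := fun f => `[< symfun_family f >].

Fact symfun_subalg_closed : subalg_closed symfun_pred.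
Proof.
split.
- apply/asboolP; split=> [m|m|]; first exact: rpred1.
  + exact: (rmorph1 (@mtrunc m)).
  + by exists 1%N => m; rewrite msize1.
- move=> c f g /asboolP[sf cf [D df]] /asboolP[sg cg [E dg]].
  apply/asboolP; split=> [m|m|].
  + exact/rpredD/sg/rpredZ/sf.
  + have := linearP (@mtrunc m) c (f m.+1) (g m.+1); rewrite /= cf cg; exact.
  + exists (maxn D E) => m; apply: leq_trans (mmeasureD_le _ _ _) _.
    by rewrite geq_max !leq_max (leq_trans (msizeZ_le _ _) (df m)) dg orbT.
- move=> f g /asboolP[sf cf [D df]] /asboolP[sg cg [E dg]].
  apply/asboolP; split=> [m|m|].
  + exact/rpredM/sg/sf.
  + have := rmorphM (@mtrunc m) (f m.+1) (g m.+1); rewrite /= cf cg; exact.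
  + exists (D + E).+1 => m.
    by apply: leq_trans (msizeM_le _ _) _; rewrite ltnS leq_add.
Qed.

HB.instance Definition _ :=
  GRing.isSubalgClosed.Build rat polyfam symfun_pred symfun_subalg_closed.

Record symfun : Type :=
  SymFun { symfun_val : polyfam; symfun_valP : symfun_val \in symfun_pred }.

HB.instance Definition _ := [isSub for symfun_val].
HB.instance Definition _ := [Choice of symfun by <:].
HB.instance Definition _ := [SubChoice_isSubAlgebra of symfun by <:].
HB.instance Definition _ := [SubNzRing_isSubComNzRing of symfun by <:].

Definition symfun_fun (f : symfun) : forall m : nat, {mpoly rat[m]} := symfun_val f.
Coercion symfun_fun : symfun >-> Funclass.

Lemma symfunE (f : symfun) : symfun_family f.
Proof. exact/asboolP/(symfun_valP f). Qed.

Lemma mtruncX_widen m (i : 'I_m) : mtrunc 'X_(widen_ord (leqnSn m) i) = 'X_i.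
Proof.
rewrite /mtrunc comp_mpolyXU -tnth_nth tnth_mktuple.
have -> : widen_ord (leqnSn m) i = lift ord_max i.
  by apply: val_inj; rewrite /= /bump leqNgt ltn_ord.
by rewrite liftK.
Qed.

Lemma mtruncX_max m : mtrunc 'X_(@ord_max m) = 0.
Proof. by rewrite /mtrunc comp_mpolyXU -tnth_nth tnth_mktuple unlift_none. Qed.

Lemma mcoeff_mtrunc m (p : {mpoly rat[m.+1]}) (u : 'X_{1..m}) :
  (mtrunc p)@_u = p@_(mnmwiden u).
Proof.
rewrite [in LHS](mpolyE p) [in RHS](mpolyE p) [mtrunc _]raddf_sum /=.
rewrite !raddf_sum /=; apply: eq_bigr => v _; rewrite linearZ /= !mcoeffZ.
congr (_ * _).
have -> : mtrunc 'X_[v] =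
    \prod_(i < m) 'X_i ^+ v (widen_ord (leqnSn m) i) * 0 ^+ v ord_max.
  rewrite mpolyXE_id rmorph_prod big_ord_recr /= rmorphXn /= mtruncX_max.
  by congr (_ * _); apply: eq_bigr => i _; rewrite rmorphXn /= mtruncX_widen.
have [v0|v_n0] := eqVneq (v ord_max) 0%N; last first.
  rewrite expr0n (negbTE v_n0) mulr0 mcoeff0 mcoeffX.
  by case: eqP => // vu; rewrite vu mnmwiden_ordmax eqxx in v_n0.
rewrite v0 expr0 mulr1.
pose w := [multinom v (widen_ord (leqnSn m) i) | i < m].
have vw : v = mnmwiden w.
  apply/mnmP => i; have [j ->|->] := unliftP ord_max i.
    have -> : lift ord_max j = widen_ord (leqnSn m) j.
      by apply: val_inj; rewrite /= /bump leqNgt ltn_ord.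
    by rewrite mnmwiden_widen mnmE.
  by rewrite mnmwiden_ordmax.
rewrite vw; under eq_bigr => i _ do rewrite mnmwiden_widen.
by rewrite -mpolyXE_id -mwidenX mwiden_mnmwiden.
Qed.

Lemma mtrunc_mwiden m (p : {mpoly rat[m]}) : mtrunc (mwiden p) = p.
Proof. by apply/mpolyP => u; rewrite mcoeff_mtrunc mwiden_mnmwiden. Qed.

Lemma dhomog_msize_le m (p : {mpoly rat[m]}) d :
  p \is d.-homog -> (msize p <= d.+1)%N.
Proof.
move=> /dhomogP hp; rewrite msizeE; apply/bigmax_leqP_seq => u up _.
by rewrite ltnS hp.
Qed.

Lemma dhomog_Xexp m (i : 'I_m) k : ('X_i ^+ k : {mpoly rat[m]}) \is k.-homog.
Proof.
by have := @dhomogMn m rat mdeg 1 'X_i k; rewrite mul1n; apply; rewrite dhomogX /= mdeg1.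
Qed.

Definition esym_fam (n : nat) : polyfam := fun m => mesym m rat n.

Fact esym_famP n : esym_fam n \in symfun_pred.
Proof.
apply/asboolP; split=> [m|m|].
- exact: mesym_sym.
- rewrite /esym_fam; case: n => [|n]; first by rewrite !mesym0E rmorph1.
  by rewrite mesymSS rmorphD rmorphM /= mtruncX_max mulr0 addr0 mtrunc_mwiden.
- by exists n.+1 => m; exact/dhomog_msize_le/dhomog_mesym.
Qed.

Definition esym (n : nat) : symfun := SymFun (esym_famP n).

(* The junk case k = 0 is set to p_0 = 1. *)
Definition psum_fam (k : nat) : polyfam :=
  fun m => if k == 0%N then 1 else \sum_(i < m) 'X_i ^+ k.

Fact psum_famP k : psum_fam k \in symfun_pred.
Proof.
apply/asboolP; rewrite /psum_fam; case: eqP => [_|/eqP k0]; split=> [m|m|].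
- exact: rpred1.
- exact: rmorph1.
- by exists 1%N => m; rewrite msize1.
- apply/issymP => s; rewrite rmorph_sum /= [RHS](reindex_inj (@perm_inj _ s)) /=.
  by apply: eq_bigr => i _; rewrite rmorphXn /= /msym mmapX mmap1U.
- rewrite big_ord_recr rmorphD rmorphXn rmorph_sum /= mtruncX_max.
  rewrite expr0n (negbTE k0) addr0.
  by apply: eq_bigr => i _; rewrite rmorphXn /= mtruncX_widen.
- exists k.+1 => m; apply: dhomog_msize_le; apply: rpred_sum => i _.
  exact: dhomog_Xexp.
Qed.

Definition psum (k : nat) : symfun := SymFun (psum_famP k).

Definition psum_part (la : seq nat) : symfun := \prod_(k <- la) psum k.

(* In the variables x_0, ..., x_(m-1) the generating function
   \prod_k (1 + x_k t + ... + x_k^d t^d) of the h_n^[d] is a polynomial in t. *)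
Definition hgen (d m : nat) : {poly {mpoly rat[m]}} :=
  \prod_(k < m) \sum_(j < d.+1) ('X_k ^+ j) *: 'X^j.

Definition hsym_fam (d n : nat) : polyfam := fun m => (hgen d m)`_n.

Lemma hgen_homog d m n : (hgen d m)`_n \is n.-homog.
Proof.
rewrite /hgen; elim/big_rec: _ n => [|k p _ IHp] n.
  by rewrite coef1; case: n => [|n]; rewrite (dhomog1, dhomog0).
rewrite coefM; apply: rpred_sum => i _.
have le_in : (i <= n)%N by rewrite -ltnS.
suff hi : (\sum_(j < d.+1) 'X_k ^+ j *: 'X^j : {poly {mpoly rat[m]}})`_i \is i.-homog.
  by have := dhomogM hi (IHp (n - i)%N); rewrite subnKC.
rewrite coef_sum; apply: rpred_sum => j _; rewrite coefZ coefXn.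
case: eqP => [->|_]; last by rewrite mulr0 dhomog0.
rewrite mulr1; exact: dhomog_Xexp.
Qed.

Fact hsym_famP d n : hsym_fam d n \in symfun_pred.
Proof.
apply/asboolP; rewrite /hsym_fam; split=> [m|m|].
- apply/issymP => s; rewrite -(coef_map (msym s)) /hgen; congr ((polyseq _)`_n).
  rewrite rmorph_prod [RHS](reindex_inj (@perm_inj _ s)) /=.
  apply: eq_bigr => k _; rewrite rmorph_sum; apply: eq_bigr => j _.
  by rewrite /= map_polyZ map_polyXn /= rmorphXn /= /msym mmapX mmap1U.
- rewrite -(coef_map (@mtrunc m)) /hgen; congr ((polyseq _)`_n).
  rewrite big_ord_recr rmorphM rmorph_prod /= [X in _ * X](_ : _ = 1).
    rewrite mulr1; apply: eq_bigr => k _; rewrite rmorph_sum.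
    apply: eq_bigr => j _.
    by rewrite /= map_polyZ map_polyXn /= rmorphXn /= mtruncX_widen.
  rewrite rmorph_sum big_ord_recl big1 => [|j _] /=.
    by rewrite map_polyZ map_polyXn /= !expr0 rmorph1 scale1r addr0.
  by rewrite map_polyZ rmorphXn /= mtruncX_max expr0n /= scale0r.
- exists n.+1 => m; exact/dhomog_msize_le/hgen_homog.
Qed.

Definition hsym (d n : nat) : symfun := SymFun (hsym_famP d n).

Lemma hsym0 d : hsym d 0 = 1.
Proof.
apply: val_inj; apply: functional_extensionality_dep => m /=.
rewrite /hsym_fam /hgen coef0_prod.
apply: big1 => k _; rewrite coef_sum big_ord_recl big1 => [|j _].
  by rewrite coefZ coefXn expr0 mulr1 addr0.
by rewrite coefZ coefXn mulr0.
Qed.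

Lemma esym0 : esym 0 = 1.
Proof.
by apply: val_inj; apply: functional_extensionality_dep => m; exact: mesym0E.
Qed.

Lemma symfun_stable N (f : symfun) :
  (forall m, (msize (f m) <= N)%N) -> f N = 0 -> f = 0.
Proof.
move=> df fN0; have [sf cf _] := symfunE f.
apply: val_inj; apply: functional_extensionality_dep => m; rewrite -[RHS]/0.
have up k : f (N + k)%N = 0.
  elim: k => [|k IHk]; first by rewrite addn0.
  rewrite addnS; apply/mpolyP => u; rewrite mcoeff0.
  have [|lt_u] := leqP N (mdeg u).
    by move=> le_u; apply: memN_msupp_eq0; apply: msize_mdeg_ge; apply: leq_trans le_u.
  have [i /eqP ui0] : exists i, u i == 0%N.
    apply/existsP; apply: contraLR lt_u => /existsPn u_gt0.
    rewrite -leqNgt mdegE; apply: leq_trans (_ : \sum_(i < (N + k).+1) 1 <= _)%N.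
      by rewrite sum1_card card_ord leqW ?leq_addr.
    by apply: leq_sum => i _; rewrite lt0n; apply: u_gt0.
  pose s := tperm i ord_max.
  rewrite -(msym_coeff _ s (sf _)).
  set v := [multinom _ | _ < _].
  have v0 : v ord_max = 0%N by rewrite mnmE tpermR.
  have -> : v = mnmwiden [multinom v (widen_ord (leqnSn _) j) | j < (N + k)%N].
    apply/mnmP => j; have [l ->|->] := unliftP ord_max j.
      have -> : lift ord_max l = widen_ord (leqnSn (N + k)) l.
        by apply: val_inj; rewrite /= /bump leqNgt ltn_ord.
      by rewrite mnmwiden_widen [RHS]mnmE.
    by rewrite mnmwiden_ordmax.
  by rewrite -mcoeff_mtrunc cf IHk mcoeff0.
have down k l : (l + k)%N = N -> f l = 0.
  elim: k l => [|k IHk] l; first by rewrite addn0 => ->.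
  by rewrite addnS -addSn => /IHk fl; rewrite -cf fl rmorph0.
have [le_mN|lt_Nm] := leqP m N; first exact: down (subnKC le_mN).
by have := up (m - N)%N; rewrite subnKC // ltnW.
Qed.

Section Free.
Variables (A : comAlgType rat) (g : nat -> A).

(* The value of the polynomial t at (g_1, ..., g_N). *)
Definition gen_eval (N : nat) (t : {mpoly rat[N]}) : A :=
  mmap (in_alg A) (fun i : 'I_N => g i.+1) t.

HB.instance Definition _ N := GRing.RMorphism.copy (@gen_eval N)
  (mmap (in_alg A) (fun i : 'I_N => g i.+1)).

Lemma gen_evalZ N c (t : {mpoly rat[N]}) : gen_eval (c *: t) = c *: gen_eval t.
Proof. by rewrite /gen_eval mmapZ /= mulr_algl. Qed.

Lemma gen_evalX N (i : 'I_N) : gen_eval 'X_i = g i.+1.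
Proof. by rewrite /gen_eval mmapX mmap1U. Qed.

Lemma gen_evalE N (t : {mpoly rat[N]}) :
  gen_eval t = \sum_(u <- msupp t) t@_u *: \prod_(i < N) g i.+1 ^+ u i.
Proof. by apply: eq_bigr => u _; rewrite mulr_algl. Qed.

Lemma gen_eval_mwiden N (t : {mpoly rat[N]}) : gen_eval (mwiden t) = gen_eval t.
Proof.
rewrite (mpolyE t) [mwiden _]raddf_sum ![gen_eval _]raddf_sum /=.
apply: eq_bigr => u _; rewrite mwidenZ !gen_evalZ mwidenX /gen_eval !mmapX /mmap1.
rewrite big_ord_recr /= mnmwiden_ordmax expr0 mulr1; congr (_ *: _).
by apply: eq_bigr => i _; rewrite mnmwiden_widen.
Qed.

End Free.

Lemma gen_eval_lrmorph (A B : comAlgType rat) (phi : {lrmorphism A -> B}) g N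
    (t : {mpoly rat[N]}) : phi (gen_eval g t) = gen_eval (phi \o g) t.
Proof.
rewrite !gen_evalE rmorph_sum; apply: eq_bigr => u _ /=; rewrite linearZ rmorph_prod.
by congr (_ *: _); apply: eq_bigr => i _; rewrite rmorphXn.
Qed.

Definition symfun_at (m : nat) (f : symfun) : {mpoly rat[m]} := f m.

Fact symfun_at_linear m : linear (@symfun_at m). Proof. by []. Qed.
Fact symfun_at_monoid m : monoid_morphism (@symfun_at m). Proof. by []. Qed.
HB.instance Definition _ m :=
  GRing.isLinear.Build rat symfun {mpoly rat[m]} _ (@symfun_at m)
    (@symfun_at_linear m).
HB.instance Definition _ m :=
  GRing.isMonoidMorphism.Build symfun {mpoly rat[m]} (@symfun_at m)
    (@symfun_at_monoid m).

Lemma esym_evalE m N (t : {mpoly rat[N]}) :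
  gen_eval esym t m = \sum_(u <- msupp t) t@_u *: \prod_(i < N) mesym m rat i.+1 ^+ u i.
Proof.
rewrite -[LHS]/(symfun_at m (gen_eval esym t)) gen_eval_lrmorph gen_evalE.
by [].
Qed.

Lemma esym_eval_diag N (t : {mpoly rat[N]}) :
  gen_eval esym t N = t \mPo [tuple mesym N rat i.+1 | i < N].
Proof.
rewrite esym_evalE comp_mpolyEX; apply: eq_bigr => u _.
rewrite comp_mpolyX; congr (_ *: _); apply: eq_bigr => i _.
by rewrite tnth_mktuple.
Qed.

Lemma esym_eval_msize m N (t : {mpoly rat[N]}) :
  (msize (gen_eval esym t m) <= mweight t)%N.
Proof.
rewrite esym_evalE; apply: leq_trans (mmeasure_sum _ _ _ _) _.
apply/bigmax_leqP_seq => u ut _.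
apply: leq_trans (mmeasure_mnm_lt (mnmwgt : measure N) ut) => /=.
apply: leq_trans (msizeZ_le _ _) _; apply: dhomog_msize_le.
rewrite /mnmwgt; elim/big_rec2: _ => [|i d p _ hp]; first exact: dhomog1.
by apply: dhomogM => //; rewrite mulnC; apply/dhomogMn/dhomog_mesym.
Qed.

Lemma esym_gen (f : symfun) : exists N (t : {mpoly rat[N]}), f = gen_eval esym t.
Proof.
have [sf _ [N df]] := symfunE f.
have [t [tf wt]] := sym_fundamental (sf N).
exists N, t; apply/eqP; rewrite -subr_eq0; apply/eqP.
apply: (@symfun_stable N) => [m|].
  rewrite -[symfun_fun _ m]/(f m - gen_eval esym t m).
  apply: leq_trans (mmeasureD_le _ _ _) _; rewrite mmeasureN geq_max df /=.
  apply: leq_trans (esym_eval_msize _ _) _.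
  exact: leq_trans wt (df N).
by rewrite -[symfun_fun _ N]/(f N - gen_eval esym t N) esym_eval_diag tf subrr.
Qed.

Lemma gen_eval_up (A : comAlgType rat) (g : nat -> A) N K (t : {mpoly rat[N]}) :
  (N <= K)%N -> exists s : {mpoly rat[K]},
    gen_eval esym s = gen_eval esym t /\ gen_eval g s = gen_eval g t.
Proof.
move=> /subnKC <-; elim: (K - N)%N => [|k [s [es gs]]].
  by rewrite addn0; exists t.
by rewrite addnS; exists (mwiden s); rewrite !gen_eval_mwiden.
Qed.

Lemma esym_free N (s t : {mpoly rat[N]}) : gen_eval esym s = gen_eval esym t -> s = t.
Proof.
move=> /(congr1 (fun f : symfun => f N)); rewrite !esym_eval_diag.
exact: msym_fundamental_un.
Qed.

Section Universal.
Variables (A : comAlgType rat) (g : nat -> A).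
Hypothesis g0 : g 0%N = 1.

Definition univ_rel (f : symfun) (a : A) : Prop :=
  exists N (t : {mpoly rat[N]}), f = gen_eval esym t /\ a = gen_eval g t.

Lemma univ_rel_fun f a b : univ_rel f a -> univ_rel f b -> a = b.
Proof.
move=> [N [t [-> ->]]] [K [s [st ->]]].
have [t' [et <-]] := gen_eval_up g t (leq_maxl N K).
have [s' [es <-]] := gen_eval_up g s (leq_maxr N K).
by congr gen_eval; apply: esym_free; rewrite et es.
Qed.

Lemma univ_rel_total f : exists a, univ_rel f a.
Proof. by have [N [t ->]] := esym_gen f; exists (gen_eval g t), N, t. Qed.

Definition univ_map (f : symfun) : A := sval (cid (univ_rel_total f)).

Lemma univ_mapE N (t : {mpoly rat[N]}) : univ_map (gen_eval esym t) = gen_eval g t.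
Proof.
apply: (@univ_rel_fun (gen_eval esym t)); last by exists N, t.
exact: (svalP (cid (univ_rel_total _))).
Qed.

Lemma esym_gen2 (f h : symfun) : exists N (s t : {mpoly rat[N]}),
  f = gen_eval esym s /\ h = gen_eval esym t.
Proof.
have [N [s ->]] := esym_gen f; have [K [t ->]] := esym_gen h.
have [s' [<- _]] := gen_eval_up g s (leq_maxl N K).
have [t' [<- _]] := gen_eval_up g t (leq_maxr N K).
by exists (maxn N K), s', t'.
Qed.

Fact univ_map_linear : linear univ_map.
Proof.
move=> c f h; have [N [s [t [-> ->]]]] := esym_gen2 f h.
by rewrite -gen_evalZ -rmorphD !univ_mapE rmorphD /= gen_evalZ.
Qed.

Fact univ_map_monoid : monoid_morphism univ_map.
Proof.
split=> [|f h]; first by rewrite -(rmorph1 (@gen_eval _ esym 0)) univ_mapE rmorph1.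
have [N [s [t [-> ->]]]] := esym_gen2 f h.
by rewrite -rmorphM !univ_mapE rmorphM.
Qed.

HB.instance Definition _ := GRing.isLinear.Build rat symfun A _ univ_map univ_map_linear.
HB.instance Definition _ := GRing.isMonoidMorphism.Build symfun A univ_map univ_map_monoid.

Lemma symfun_hom_exists :
  exists phi : {lrmorphism symfun -> A}, forall n, phi (esym n) = g n.
Proof.
exists univ_map => -[|n] /=; first by rewrite esym0 rmorph1.
by rewrite -[esym n.+1](gen_evalX esym (@ord_max n)) univ_mapE gen_evalX.
Qed.

End Universal.

Lemma symfun_hom_unique (A : comAlgType rat) (phi psi : {lrmorphism symfun -> A}) :
  (forall n, phi (esym n) = psi (esym n)) -> phi =1 psi.
Proof.
move=> eq_e f; have [N [t ->]] := esym_gen f.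
rewrite !gen_eval_lrmorph !gen_evalE; apply: eq_bigr => u _; congr (_ *: _).
by apply: eq_bigr => i _; rewrite /= eq_e.
Qed.

(* The algebra endomorphism determined by [omegaE], see [symfun_hom_unique]. *)
Definition omega (d : nat) : {lrmorphism symfun -> symfun} :=
  sval (cid (symfun_hom_exists (hsym0 d))).

Lemma omegaE d n : omega d (esym n) = hsym d n.
Proof. exact: (svalP (cid (symfun_hom_exists (hsym0 d)))). Qed.

Definition is_partition (n : nat) (la : seq nat) : bool :=
  [&& sorted geq la, 0%N \notin la & sumn la == n].

Definition eps (la : seq nat) : rat := (-1) ^+ (sumn la - size la).

(* n_i is [count_mem i la]; n_(k(d+1)) = 0 as soon as k > |la|. *)
Definition Dcoef (d : nat) (la : seq nat) : rat :=
  (- d%:R) ^+ (\sum_(1 <= k < (sumn la).+1) count_mem (k * d.+1)%N la).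

(* Main.v *)
(** The coefficients of [hgen d] satisfy the Newton-type recurrence
    [n h_n = \sum_(1 <= i <= n) c_i p_i h_(n-i)], where [c_i] is [-d] if [d+1]
    divides [i] and [1] otherwise: this is the logarithmic derivative of
    [\prod_k (1 - (x_k t)^(d+1)) / (1 - x_k t)]. For [d = 1] it is Newton's
    identity for the [e_n], with [c_i = (-1)^(i-1)]. Applying [omega] to the case
    [d = 1] and comparing with the case [d] determines [omega (p_n)] by induction
    on [n]. *)
Require Import Defs.
From HB Require Import structures.
From mathcomp Require Import all_boot all_order all_fingroup all_algebra.
From mathcomp Require Import mpoly boolp.

Set Implicit Arguments.
Unset Strict Implicit.
Unset Printing Implicit Defensive.

Import GRing.Theory.
Local Open Scope ring_scope.

Section LogDerivative.
Variable A : comNzRingType.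
Implicit Types (f g : {poly A}) (b c : nat -> A).

(* f' = f \sum_i b_i t^i as power series, expressed by truncations. *)
Definition logderiv f b : Prop :=
  forall N n, (n < N)%N -> f^`()`_n = (\poly_(i < N) b i * f)`_n.

Lemma logderiv1 : logderiv 1 (fun=> 0).
Proof.
by move=> N n _; rewrite derivC coef0 mulr1 coef_poly; case: ifP.
Qed.

Lemma logderivM f g b c :
  logderiv f b -> logderiv g c -> logderiv (f * g) (fun i => b i + c i).
Proof.
move=> hf hg N n ltnN.
have -> : \poly_(i < N) (b i + c i) = \poly_(i < N) b i + \poly_(i < N) c i.
  by apply/polyP => i; rewrite coefD !coef_poly; case: ifP; rewrite ?addr0.
(* The coefficient of index n of a product only involves coefficients of index at most n < N of its
   factors. *)
have low (p q : {poly A}) : (forall j, (j < N)%N -> p`_j = q`_j) ->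
    forall r : {poly A}, (p * r)`_n = (q * r)`_n.
  move=> pq r; rewrite !coefM; apply: eq_bigr => j _; congr (_ * _).
  by apply: pq; apply: leq_ltn_trans ltnN; rewrite -ltnS.
rewrite derivM mulrDl !coefD (low _ _ (hf N)) [f * g^`()]mulrC (low _ _ (hg N)).
by rewrite mulrA [f * g]mulrC mulrA.
Qed.

Lemma logderiv_prod (I : Type) (r : seq I) (f : I -> {poly A})
    (b : I -> nat -> A) :
  (forall k, logderiv (f k) (b k)) ->
  logderiv (\prod_(k <- r) f k) (fun i => \sum_(k <- r) b k i).
Proof.
move=> hf; elim: r => [|k r IHr].
  rewrite big_nil; have := logderiv1; congr (logderiv _ _).
  by apply/funext => i; rewrite big_nil.
rewrite big_cons; have := logderivM (hf k) IHr; congr (logderiv _ _).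
by apply/funext => i; rewrite big_cons.
Qed.

Lemma logderiv_coef f b n : logderiv f b ->
  f`_n.+1 *+ n.+1 = \sum_(i < n.+1) b i * f`_(n - i).
Proof.
move=> hf; rewrite -coef_deriv (hf n.+1 n) // coefM.
by apply: eq_bigr => i _; rewrite coef_poly ltn_ord.
Qed.

End LogDerivative.

(** The ring is a parameter because these serve both as ring elements in the logarithmic derivative
    and as rational scalars in the recurrence. *)
Definition newton_coef (R : pzRingType) (d i : nat) : R :=
  if (d.+1 %| i)%N then - d%:R else 1.

(** Exactly one of d+1 consecutive indices is a multiple of d+1, so one term -d cancels d terms
    1. *)
Lemma newton_coef_window (R : pzRingType) d n :
  \sum_(i < d.+1) newton_coef R d (n + i).+1 = 0.
Proof.
elim: n => [|n IH].
  rewrite big_ord_recr /= /newton_coef add0n dvdnn.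
  rewrite (eq_bigr (fun=> 1)) => [|i _]; last first.
    by rewrite add0n gtnNdvd // ltnS.
  by rewrite sumr_const card_ord subrr.
(* Sliding the window: the entering and leaving indices differ by d+1, so their coefficients
   agree. *)
rewrite big_ord_recr -[RHS]IH [RHS]big_ord_recl /= addrC addSnnS; congr (_ + _).
  by rewrite /newton_coef addn0 -addSn dvdn_addl.
by apply: eq_bigr => i _; rewrite /bump /= addSnnS.
Qed.

Lemma newton_coef1 (R : pzRingType) k : newton_coef R 1 k.+1 = (-1) ^+ k.
Proof. by rewrite /newton_coef dvdn2 /= -signr_odd; case: (odd k). Qed.

(* Coefficientwise, this is the vanishing of the sum of the [newton_coef]s over
   [d+1] consecutive indices. *)
Lemma logderiv_geom (A : comNzRingType) d (x : A) :
  logderiv (\sum_(j < d.+1) x ^+ j *: 'X^j)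
    (fun i => newton_coef A d i.+1 * x ^+ i.+1).
Proof.
rewrite -poly_def => N n ltnN; rewrite coef_deriv coefM coef_poly.
have -> : \sum_(i < n.+1) (\poly_(i < N) (newton_coef A d i.+1 * x ^+ i.+1))`_i
      * (\poly_(j < d.+1) x ^+ j)`_(n - i) =
    x ^+ n.+1 * \sum_(i < n.+1 | (n - i <= d)%N) newton_coef A d i.+1.
  rewrite mulr_sumr [RHS]big_mkcond; apply: eq_bigr => i _ /=.
  have le_in : (i <= n)%N by rewrite -ltnS.
  rewrite !coef_poly (leq_ltn_trans le_in ltnN) ltnS.
  case: ifP => _; last by rewrite mulr0.
  by rewrite -mulrA -exprD addSn subnKC // mulrC.
(* If n < d, every index is below d+1 and every coefficient is 1. Otherwise the last d+1 indices
   form a full window and the left side vanishes by degree. *)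
have [ltnd|ledn] := ltnP n d.
  rewrite ltnS ltnd -mulr_natr; congr (_ * _).
  rewrite (eq_bigl predT) => [|i]; last first.
    by rewrite (leq_trans (leq_subr _ _)) // ltnW.
  rewrite (eq_bigr (fun=> 1)) => [|i _]; first by rewrite sumr_const card_ord.
  by rewrite /newton_coef gtnNdvd // ltnS (leq_ltn_trans _ ltnd) // -ltnS.
rewrite ltnS ltnNge ledn mul0rn -(subnK ledn) -addnS big_split_ord /=.
rewrite big_pred0 => [|i]; last first.
  by apply/negbTE; rewrite -ltnNge ltn_subRL ltn_add2r.
rewrite add0r (eq_bigl predT) => [|i]; last by rewrite subnDl leq_subr.
by rewrite newton_coef_window mulr0.
Qed.

(** The factors are 1 + x_k t; splitting off the last variable reproduces the recurrence
    [mesymSS]. *)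
Lemma hsym1 n : hsym 1 n = Defs.esym n.
Proof.
apply: val_inj; apply: functional_extensionality_dep => m /=.
rewrite /hsym_fam /esym_fam.
elim: m n => [|m IHm] n.
  rewrite /hgen big_ord0 coef1; case: n => [|n]; first by rewrite mesym0E.
  by rewrite mesym_geqnE.
have -> : hgen 1 m.+1 =
    map_poly (@mwiden m rat) (hgen 1 m) * (1 + 'X_ord_max *: 'X).
  rewrite /hgen big_ord_recr rmorph_prod /=; congr (_ * _); last first.
    by rewrite big_ord_recr big_ord1 expr0 scale1r.
  apply: eq_bigr => k _; rewrite rmorph_sum; apply: eq_bigr => j _ /=.
  rewrite map_polyZ map_polyXn /= rmorphXn /= mwidenX; congr ('X_[_] ^+ _ *: _).
  apply/mnmP => i; have [l ->|->] := unliftP ord_max i.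
    have -> : lift ord_max l = widen_ord (leqnSn m) l.
      by apply: val_inj; rewrite /= /bump leqNgt ltn_ord.
    by rewrite mnmwiden_widen !mnm1E.
  rewrite mnmwiden_ordmax mnm1E; case: eqP => // /(congr1 val) /= km.
  by have := ltn_ord k; rewrite km ltnn.
rewrite mulrDr mulr1 coefD -scalerAr coefZ coefMX !coef_map /=.
case: n => [|n] /=; first by rewrite mulr0 addr0 IHm !mesym0E mwiden1.
by rewrite mesymSS !IHm mulrC.
Qed.

Lemma hsym_newton d n :
  hsym d n.+1 *+ n.+1 =
    \sum_(i < n.+1) newton_coef rat d i.+1 *: (psum i.+1 * hsym d (n - i)).
Proof.
apply: val_inj; apply: functional_extensionality_dep => m.
rewrite -[LHS]/(symfun_at m _) -[RHS]/(symfun_at m _) raddfMn raddf_sum /=.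
rewrite /hsym_fam.
rewrite (logderiv_coef n (logderiv_prod _ (fun k => logderiv_geom d 'X_k))).
apply: eq_bigr => i _.
rewrite -[RHS]/(newton_coef rat d i.+1 *:
  ((\sum_(k < m) 'X_k ^+ i.+1) * (hgen d m)`_(n - i))) -mulr_sumr -mulrA.
rewrite -mulr_algl; congr (_ * _).
by rewrite /newton_coef; case: ifP => _; rewrite ?scale1r // scaleNr scaler_nat.
Qed.

Lemma omega_psum d k :
  omega d (psum k.+1) = ((-1) ^+ k * newton_coef rat d k.+1) *: psum k.+1.
Proof.
elim/ltn_ind: k => k IHk.
have := congr1 (omega d) (hsym_newton 1 k).
rewrite hsym1 raddfMn /= omegaE hsym_newton raddf_sum /=.
rewrite [LHS]big_ord_recr [RHS]big_ord_recr /= linearZ rmorphM /=.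
(* By induction each term with i < k gets the coefficient (-1)^i (-1)^i c_(i+1) = c_(i+1), so it
   cancels against the same term on the left. *)
under [in RHS]eq_bigr => i _.
  rewrite linearZ rmorphM /= hsym1 omegaE newton_coef1 IHk // -scalerAl scalerA.
  rewrite mulrA -expr2 -exprM mulnC exprM sqrrN expr1n mul1r.
  over.
rewrite subnn hsym0 hsym1 omegaE hsym0 !mulr1 newton_coef1 => /addrI eq_k.
by rewrite -scalerA eq_k scalerA -exprMn mulrNN mulr1 expr1n scale1r.
Qed.

(** In one variable each factor is a power of x_0, and polynomials over a field have no zero
    divisors. *)
Lemma psum_part_neq0 (la : seq nat) : 0%N \notin la -> psum_part la != 0.
Proof.
move=> la0; apply/eqP => /(congr1 (symfun_at 1)) /eqP.
rewrite rmorph0 rmorph_prod prodf_seq_eq0 => /hasP[k _] /=.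
rewrite /psum_fam; case: ifP => _; first by rewrite oner_eq0.
by rewrite big_ord1 expf_eq0 -msupp_eq0 msuppX andbF.
Qed.

(** After exchanging the sums, a part x divisible by d+1 is met once, at k = x / (d+1), which is in
    range since 1 <= k <= x <= |la|. *)
Lemma sum_count_multiples d (la : seq nat) : 0%N \notin la ->
  (\sum_(1 <= k < (sumn la).+1) count_mem (k * d.+1) la)%N = count (dvdn d.+1) la.
Proof.
move=> la0; under eq_bigr do rewrite -sum1_count big_mkcond /=.
rewrite exchange_big -sum1_count [RHS]big_mkcond /=.
apply: eq_big_seq => x xla.
have x_gt0 : (0 < x)%N by rewrite lt0n; apply: contraNneq la0 => <-.
have le_x : (x <= sumn la)%N.
  by rewrite sumnE (perm_big _ (perm_to_rem xla)) big_cons leq_addr.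
case: ifP => [/dvdnP[q def_x]|ndvd_x]; last first.
  by apply: big1 => k _; case: eqP => // def_x; rewrite def_x dvdn_mull in ndvd_x.
have q_gt0 : (0 < q)%N by case: q def_x x_gt0 => // ->.
have le_q : (q <= sumn la)%N by rewrite (leq_trans _ le_x) // def_x leq_pmulr.
rewrite (bigD1_seq q) ?mem_index_iota ?iota_uniq ?q_gt0 //= def_x eqxx.
by rewrite big1 // => k /negbTE neq_kq; rewrite eqn_pmul2r // eq_sym neq_kq.
Qed.

Lemma eigenvalue_prod d (la : seq nat) : 0%N \notin la ->
  \prod_(k <- la) ((-1) ^+ k.-1 * newton_coef rat d k) = eps la * Dcoef d la.
Proof.
move=> la0; rewrite big_split /=; congr (_ * _).
  rewrite prodrXr /eps sumnE -[size la]sum1_size; congr (_ ^+ _).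
  (* Positive parts satisfy k = (k-1) + 1 even with truncated predecessor, so the exponents k-1 add
     up to |la| - l(la). *)
  rewrite (eq_big_seq (fun k => k.-1 + 1)%N (r := la) (F1 := id)) => [|[|k] kla].
  - by rewrite big_split addnK.
  - by rewrite kla in la0.
  - by rewrite addn1.
by rewrite /Dcoef sum_count_multiples // -big_mkcond /= big_const_seq iter_mulr_1.
Qed.

Theorem proposition3p2 (n d : nat) (la : seq nat)
    (hla : is_partition n la) (hd : (0 < d)%N) :
  omega d (psum_part la) = (eps la * Dcoef d la) *: psum_part la
  /\ psum_part la != 0.
Proof.
have /and3P[_ la0 _] := hla; split; last exact: psum_part_neq0.
(* Multiplicativity of [omega d] reduces the claim to one part at a time. *)
rewrite -eigenvalue_prod // rmorph_prod -scaler_prod /=.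
apply: eq_big_seq => -[|k] kla; first by rewrite kla in la0.
exact: omega_psum.
Qed.
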